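(* Given $d\ge 2$ and $0<\varepsilon<1$, there exists $\gamma=\Theta\left(\dfrac{1}{d\log d}\cdot\dfrac{\varepsilon^2}{\log^2(1/\varepsilon)}\right)$ such that for every field $\mathbb{F}$, all $k\ge1$ and all $X\in\mathbb{F}^{d\times k}$ we have $R^{rc}_{\mathbb{F}}(G_{d,k}(X),n^{1-\gamma})\le n^{\varepsilon/d}$, where $n=d^k$.
   Context: The row-column rigidity $R^{rc}_{\mathbb{F}}(A,r)$ of $A\in\mathbb{F}^{n\times n}$ is the minimal $t$ for which there exists $Z\in\mathbb{F}^{n\times n}$ with $\operatorname{rank}(A-Z)\le r$ and every row and every column of $Z$ having at most $t$ non-zero entries. For $x\in\mathbb{F}^d$, $G_d(x)$ is the $d\times d$ matrix whose first $d-1$ columns are the first $d-1$ columns of $I_d$ and whose last column is $x$. For $X\in\mathbb{F}^{d\times k}$ with columns $X_1,\dots,X_k$, $G_{d,k}(X)=\bigotimes_{i=1}^kG_d(X_i)$ (Kronecker product). $\Theta$ hides absolute constants.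
   Formalization: log(1/ε) in the rate is read as log(max(2,1/ε)), which is unchanged for ε ≤ 1/2; with the literal rate, unbounded as ε→1, the claim fails (d=2, k=1, X all ones, ε near 1 forces γ>1, hence rank 0, while the last column has 2 > 2^{ε/2} non-zero entries). *)

(* Defs.v *)
From mathcomp Require Import all_boot all_order all_algebra.
From mathcomp Require Import boolp reals exp.
From mathcomp.real_closed Require Import mxtens.

Set Implicit Arguments.
Unset Strict Implicit.
Unset Printing Implicit Defensive.

Import Order.TTheory GRing.Theory Num.Theory.
Local Open Scope ring_scope.

Definition rc_sparse (F : fieldType) (n : nat) (Z : 'M[F]_n) (t : nat) : Prop :=
  (forall i, (#|[pred j | Z i j != 0%R]| <= t)%N) /\
  (forall j, (#|[pred i | Z i j != 0%R]| <= t)%N).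

Definition rc_approx (F : fieldType) (n : nat) (A : 'M[F]_n) (r t : nat) : Prop :=
  exists Z : 'M[F]_n, (\rank (A - Z)%R <= r)%N /\ rc_sparse Z t.

Lemma rc_approx_ex (F : fieldType) (n : nat) (A : 'M[F]_n) (r : nat) :
  exists t, `[< rc_approx A r t >].
Proof.
exists n; apply/asboolP; exists A; rewrite subrr mxrank0; split=> //.
by split=> i; rewrite (leq_trans (max_card _)) ?card_ord.
Qed.

Definition rc_rigidity (F : fieldType) (n : nat) (A : 'M[F]_n) (r : nat) : nat :=
  ex_minn (rc_approx_ex A r).

(* The Kronecker product of A_0, ..., A_(k-1), in this order; the cast is along
   d * d ^ k = d ^ k.+1. *)
Fixpoint kronmx (F : fieldType) (d k : nat) : ('I_k -> 'M[F]_d) -> 'M[F]_(d ^ k) :=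
  match k with
  | 0 => fun _ => 1%:M
  | k'.+1 => fun A =>
      castmx (esym (expnS d k'), esym (expnS d k'))
             (tensmx (A ord0) (kronmx (fun i => A (lift ord0 i))))
  end.

Definition Gmx (F : fieldType) (d : nat) (x : 'cV[F]_d) : 'M[F]_d :=
  \matrix_(i, j) (if j.+1 == d then x i ord0 else (i == j)%:R).

Definition Gkmx (F : fieldType) (d k : nat) (X : 'M[F]_(d, k)) : 'M[F]_(d ^ k) :=
  kronmx (fun i => Gmx (col i X)).

(* The rate (1 / (d log d)) * (eps^2 / log^2 (1/eps)).  The argument of the last
   logarithm is read as max(2, 1/eps), which is 1/eps for eps <= 1/2: as eps
   tends to 1, log (1/eps) vanishes and the uncapped rate is unbounded, while
   exponents gamma > 1 would force rank 0. *)
Definition gamma_rate (R : realType) (d : nat) (eps : R) : R :=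
  (d%:R * ln d%:R)^-1 * (eps ^+ 2 / ln (Num.max 2 eps^-1) ^+ 2).

(* Main.v *)
(** Index rows and columns by words in [{0,...,d-1}^k] and let the weight of a
word be its number of letters [d-1].  A nonzero entry [(i,j)] of [G_{d,k}(X)]
forces [i] and [j] to agree wherever [j] does not have the letter [d-1], hence
weight [i] <= weight [j].  Deleting the rows of weight below [a] and the columns
of weight above [a+s] thus costs a rank equal to the number of words whose
weight is outside [[a, a+s]], and leaves entries where [i] arises from [j] by
changing at most [s] letters.  With [mu = k/d] the mean weight,
[L = ln (max 2 (1/eps))] and [s] about [kappa mu eps / L], few such changes are
possible, and it remains to place the window so that it misses at most
[n exp(-c mu (eps/L)^2)] words.  For large [mu (eps/L)^2] a centered window does
this by the Chernoff bound; otherwise the exponential is [1 - O(mu (eps/L)^2)],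
and by pigeonhole some window within [O(sqrt mu)] of the mean is heavy enough. *)

Require Import Defs.
From mathcomp Require Import all_boot all_order all_algebra.
From mathcomp Require Import boolp reals sequences exp.
From mathcomp.real_closed Require Import mxtens.
From mathcomp Require Import zify ring lra.

Set Implicit Arguments.
Unset Strict Implicit.
Unset Printing Implicit Defensive.

Import Order.TTheory GRing.Theory Num.Theory.
Local Open Scope ring_scope.

(** * Rank of matrices supported on few rows and columns *)

Lemma rc_rigidity_le (F : fieldType) (n : nat) (A : 'M[F]_n) (r t : nat) :
  rc_approx A r t -> (rc_rigidity A r <= t)%N.
Proof.
move=> At; rewrite /rc_rigidity; case: ex_minnP => m _; apply.
exact/asboolP.
Qed.

Lemma rank_le_rows (F : fieldType) (m n : nat) (B : 'M[F]_(m, n)) (P : pred 'I_m) :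
  (forall i j, ~~ P i -> B i j = 0) -> (\rank B <= #|P|)%N.
Proof.
move=> B0; have -> : B = (rowsub (fun i : 'I_#|P| => enum_val i) 1%:M)^T *m
    rowsub (fun i : 'I_#|P| => enum_val i) B.
  apply/matrixP => i j; rewrite !mxE; case: (boolP (P i)) => Pi; last first.
    rewrite B0 // big1 // => l _; rewrite !mxE.
    have := enum_valP l; case: eqP => [->|_] //; rewrite ?mul0r //.
    by rewrite unfold_in (negPf Pi).
  rewrite (bigD1 (enum_rank_in (A := P) Pi i)) //= !mxE enum_rankK_in // eqxx mul1r.
  rewrite big1 ?addr0 // => l li; rewrite !mxE; case: eqP => [il|]; last by rewrite mul0r.
  by case/eqP: li; apply: enum_val_inj; rewrite enum_rankK_in.
by rewrite (leq_trans (mxrankM_maxl _ _)) ?rank_leq_col.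
Qed.

(** Split off the rows in [P]: the remainder lives in the columns of [Q], and rank is
    subadditive. *)
Lemma rank_le_rows_cols (F : fieldType) (m n : nat) (B : 'M[F]_(m, n))
    (P : pred 'I_m) (Q : pred 'I_n) :
  (forall i j, B i j != 0 -> P i || Q j) -> (\rank B <= #|P| + #|Q|)%N.
Proof.
move=> BPQ; pose C : 'M[F]_(m, n) := \matrix_(i, j) if P i then B i j else 0.
rewrite -[B](subrK C) addrC (leq_trans (mxrank_add _ _)) // leq_add //.
  by apply: rank_le_rows => i j /negPf nPi; rewrite mxE nPi.
rewrite -mxrank_tr; apply: rank_le_rows => j i nQj; rewrite !mxE.
case: ifP => Pi; first by rewrite subrr.
rewrite subr0; apply/eqP/negPn/negP => /BPQ; by rewrite Pi (negPf nQj).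
Qed.

(** * Words as indices, and the support of the Kronecker product *)

Fixpoint digits (d k : nat) : 'I_(d ^ k) -> {ffun 'I_k -> 'I_d} :=
  match k with
  | 0 => fun _ => ffun0 (card_ord 0)
  | k'.+1 => fun i =>
      let u := mxtens_unindex (cast_ord (expnS d k') i) in
      [ffun l => if unlift ord0 l is Some l' then digits u.2 l' else u.1]
  end.

Lemma digits_inj (d k : nat) : injective (@digits d k).
Proof.
elim: k => [|k IHk] i j eq_ij.
  by apply: val_inj; case: i j {eq_ij} => [[|i] ?] [[|j] ?].
apply: (@cast_ord_inj _ _ (expnS d k)); apply: (can_inj (@mxtens_unindexK _ _)).
move: eq_ij => /=; set u := mxtens_unindex _; set v := mxtens_unindex _ => /ffunP uv.
apply: injective_projections.
  by have := uv ord0; rewrite !ffunE unlift_none.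
by apply: IHk; apply/ffunP => l; have := uv (lift ord0 l); rewrite !ffunE liftK.
Qed.

Lemma digits_bij (d k : nat) : bijective (@digits d k).
Proof.
by apply: inj_card_bij (@digits_inj d k) _; rewrite card_ffun !card_ord.
Qed.

Lemma card_digits (d k : nat) (P : pred {ffun 'I_k -> 'I_d}) :
  #|[pred i | P (digits i)]| = #|P|.
Proof.
rewrite -(card_image (@digits_inj d k)); apply: eq_card => f.
have [g digitsK gK] := digits_bij d k.
apply/imageP/idP => [[i Pi ->] //|Pf]; by exists (g f); rewrite ?gK // inE gK.
Qed.

(** [digits] peels off the first letter through the same cast and tensor indexing as [kronmx], so
    the two recursions unfold together. *)
Lemma kronmxE (F : fieldType) (d k : nat) (A : 'I_k -> 'M[F]_d) i j :
  kronmx A i j = \prod_l A l (digits i l) (digits j l).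
Proof.
elim: k A i j => [|k IHk] A i j.
  rewrite big_ord0 /= mxE; case: i j => [[|i] Hi] [[|j] Hj] //=.
rewrite big_ord_recl /= castmxE mxE /= IHk !ffunE unlift_none !esymK.
by congr (_ * _); apply: eq_bigr => l _; rewrite !ffunE liftK.
Qed.

Definition is_last (d : nat) (i : 'I_d) : bool := i.+1 == d.

Definition weight (d k : nat) (f : {ffun 'I_k -> 'I_d}) : nat :=
  \sum_l is_last (f l).

Definition compat (d k : nat) : rel {ffun 'I_k -> 'I_d} :=
  fun f g => [forall l, is_last (g l) || (f l == g l)].

Lemma Gkmx_compat (F : fieldType) (d k : nat) (X : 'M[F]_(d, k)) i j :
  Gkmx X i j != 0 -> compat (digits i) (digits j).
Proof.
rewrite /Gkmx kronmxE => /prodf_neq0 nz; apply/forallP => l.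
have := nz l isT; rewrite mxE /is_last; case: (_.+1 == d) => //=.
by case: (digits i l == digits j l) => //; rewrite eqxx.
Qed.

Lemma rc_approx_Gkmx (F : fieldType) (d k : nat) (X : 'M[F]_(d, k)) (a b t : nat) :
  (forall g : {ffun 'I_k -> 'I_d}, (weight g <= b)%N ->
     (#|[pred f | compat f g && (a <= weight f)]| <= t)%N) ->
  (forall f : {ffun 'I_k -> 'I_d}, (a <= weight f)%N ->
     (#|[pred g | compat f g && (weight g <= b)]| <= t)%N) ->
  rc_approx (Gkmx X)
    (#|[pred f : {ffun 'I_k -> 'I_d} | weight f < a]| +
     #|[pred f : {ffun 'I_k -> 'I_d} | b < weight f]|)%N t.
Proof.
move=> colt rowt.
pose Z : 'M[F]_(d ^ k) := \matrix_(i, j)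
  if (a <= weight (digits i))%N && (weight (digits j) <= b)%N then Gkmx X i j else 0.
exists Z; split.
  rewrite -(card_digits [pred f | weight f < a]%N) -(card_digits [pred f | b < weight f]%N).
  apply: rank_le_rows_cols => i j; rewrite !mxE /= !ltnNge -negb_and.
  by case: ifP => // _; rewrite subrr eqxx.
split => [i|j].
  case: (leqP a (weight (digits i))) => ai; last first.
    rewrite (leq_trans _ (leq0n t)) // leqn0; apply/eqP/eq_card0 => j.
    by rewrite !inE mxE leqNgt ai eqxx.
  apply: leq_trans (rowt _ ai).
  rewrite -(card_digits [pred g | compat (digits i) g && (weight g <= b)%N]).
  apply/subset_leq_card/fintype.subsetP => j; rewrite !inE mxE ai /=.
  by case: ifP => [_ /Gkmx_compat ->|]; rewrite ?eqxx.
case: (leqP (weight (digits j)) b) => bj; last first.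
  rewrite (leq_trans _ (leq0n t)) // leqn0; apply/eqP/eq_card0 => i.
  by rewrite !inE mxE (leqNgt _ b) bj andbF eqxx.
apply: leq_trans (colt _ bj).
rewrite -(card_digits [pred f | compat f (digits j) && (a <= weight f)%N]).
apply/subset_leq_card/fintype.subsetP => i; rewrite !inE mxE bj andbT /=.
by case: ifP => [_ /Gkmx_compat ->|]; rewrite ?eqxx.
Qed.

(** * Generating functions and the count of compatible words *)

Lemma sum_is_last (R : pzRingType) (d : nat) (u v : R) : (0 < d)%N ->
  \sum_(x < d) (if is_last x then u else v) = u + d.-1%:R * v.
Proof.
case: d => // d _; rewrite big_ord_recr /= {2}/is_last eqxx addrC; congr (_ + _).
rewrite (eq_bigr (fun=> v)) => [|i _]; last by rewrite /is_last /= eqSS ltn_eqF.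
by rewrite sumr_const card_ord mulr_natl.
Qed.

(** The sum factors over positions: each contributes [d - 1] ones and a single [y]. *)
Lemma sum_expr_weight (R : comPzRingType) (d k : nat) (y : R) : (0 < d)%N ->
  \sum_(f : {ffun 'I_k -> 'I_d}) y ^+ weight f = (d.-1%:R + y) ^+ k.
Proof.
move=> d_gt0; transitivity (\prod_(l < k) \sum_(x < d) y ^+ is_last x).
  by rewrite bigA_distr_bigA; apply: eq_bigr => f _; rewrite prodrXr.
rewrite (eq_bigr (fun=> d.-1%:R + y)) ?prodr_const ?card_ord // => l _.
rewrite -[d.-1%:R]mulr1 addrC -sum_is_last //.
by apply: eq_bigr => x _; case: is_last.
Qed.

(** Markov's inequality in counting form. *)
Lemma card_le_sum (R : numDomainType) (T : finType) (P : pred T) (w : T -> R) (v : R) :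
  (forall x, 0 <= w x) -> (forall x, P x -> v <= w x) -> #|P|%:R * v <= \sum_x w x.
Proof.
move=> w0 vw; rewrite mulr_natl -sumr_const.
rewrite (le_trans (ler_sum _ vw)) // [leRHS](bigID P) /=.
by rewrite lerDl sumr_ge0.
Qed.

(* The product of the flip costs over all letters is [z ^+ (weight g - weight f)]
   on compatible words and its sum over one word factors letter by letter, so it
   bounds the number of compatible words at weight distance at most [s]. *)
Definition flip_cost (R : pzSemiRingType) (z : R) (d : nat) (x y : 'I_d) : R :=
  if is_last y then (if is_last x then 1 else z) else (x == y)%:R.

Lemma flip_cost_ge0 (R : numDomainType) (z : R) (d : nat) (x y : 'I_d) :
  0 <= z -> 0 <= flip_cost z x y.
Proof. by rewrite /flip_cost; case: ifP => // _; case: ifP. Qed.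

Lemma flip_cost_col (R : pzRingType) (z : R) (d : nat) (y : 'I_d) :
  \sum_x flip_cost z x y = (1 + d.-1%:R * z) ^+ is_last y.
Proof.
have d_gt0 : (0 < d)%N by case: d y => // [[]].
rewrite /flip_cost; case: (is_last y); first by rewrite sum_is_last // expr1.
rewrite (bigD1 y) //= eqxx big1 ?addr0 // => x /negPf -> //.
Qed.

(** The sum is 1 for the letter [d - 1] and [1 + z] for any other letter. *)
Lemma flip_cost_row (R : numDomainType) (z : R) (d : nat) (x : 'I_d) :
  0 <= z -> \sum_y flip_cost z x y <= 1 + z.
Proof.
move=> z0; have d_gt0 : (0 < d)%N by case: d x => // [[]].
have lastE (y : 'I_d) : is_last x -> is_last y -> x = y.
  by rewrite /is_last => /eqP xd /eqP yd; apply: val_inj; apply: succn_inj; rewrite xd.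
apply: (@le_trans _ _ (\sum_y ((if is_last y then z else 0) + (y == x)%:R))).
  apply: ler_sum => y _; rewrite /flip_cost [y == x]eq_sym; case: ifP => ly;
    last by rewrite add0r.
  case: ifP => lx; last by rewrite lerDl ler0n.
  by rewrite (lastE y) // eqxx lerDr.
rewrite big_split /= sum_is_last // mulr0 addr0 addrC lerD2r.
by rewrite (bigD1 x) //= eqxx big1 ?addr0 // => y /negPf ->.
Qed.

Lemma expr_le_flip_cost (R : realFieldType) (z : R) (d k s : nat)
    (f g : {ffun 'I_k -> 'I_d}) : 0 < z -> z <= 1 ->
  compat f g -> (weight g <= weight f + s)%N ->
  z ^+ s <= \prod_l flip_cost z (f l) (g l).
Proof.
move=> z0 z1 /forallP fg wgf.
have zfg : z ^+ weight f * \prod_l flip_cost z (f l) (g l) = z ^+ weight g.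
  rewrite /weight -!prodrXr -big_split /=; apply: eq_bigr => l _.
  rewrite /flip_cost; have := fg l; case: ifP => /= [gl _|gl /eqP ->].
    by case: ifP; rewrite ?mulr1 ?mul1r.
  by rewrite gl eqxx mulr1.
rewrite -(ler_pM2l (exprn_gt0 (weight f) z0)) zfg -exprD.
by apply: ler_wiXn2l => //; apply: ltW.
Qed.

(** Markov's inequality with the flip costs. Only the letters [d - 1] of [g] can be changed, so the
    costs sum to a power with exponent [weight g]. *)
Lemma card_compat_col (R : realFieldType) (z : R) (d k a s : nat)
    (g : {ffun 'I_k -> 'I_d}) : 0 < z -> z <= 1 -> (weight g <= a + s)%N ->
  #|[pred f | compat f g && (a <= weight f)%N]|%:R
    <= z ^- s * (1 + d.-1%:R * z) ^+ (a + s).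
Proof.
move=> z0 z1 wg; rewrite mulrC ler_pdivlMr ?exprn_gt0 //.
apply: (@le_trans _ _ (\sum_(f : {ffun 'I_k -> 'I_d}) \prod_l flip_cost z (f l) (g l))).
  apply: card_le_sum => f; first by apply: prodr_ge0 => l _; rewrite flip_cost_ge0 // ltW.
  case/andP=> fg wf; apply: expr_le_flip_cost => //.
  by apply: leq_trans wg _; rewrite leq_add2r.
rewrite -(bigA_distr_bigA (fun l x => flip_cost z x (g l))).
rewrite (eq_bigr _ (fun l _ => flip_cost_col z (g l))) prodrXr.
by apply: ler_weXn2l => //; rewrite lerDl mulr_ge0 ?ler0n // ltW.
Qed.

(** Here every position may change, but only to the letter [d - 1]: the exponent grows to [k] while
    the base drops to [1 + z]. *)
Lemma card_compat_row (R : realFieldType) (z : R) (d k a s : nat)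
    (f : {ffun 'I_k -> 'I_d}) : 0 < z -> z <= 1 -> (a <= weight f)%N ->
  #|[pred g | compat f g && (weight g <= a + s)%N]|%:R <= z ^- s * (1 + z) ^+ k.
Proof.
move=> z0 z1 wf; rewrite mulrC ler_pdivlMr ?exprn_gt0 //.
apply: (@le_trans _ _ (\sum_(g : {ffun 'I_k -> 'I_d}) \prod_l flip_cost z (f l) (g l))).
  apply: card_le_sum => g.
    by apply: prodr_ge0 => l _; rewrite flip_cost_ge0 // ltW.
  case/andP=> fg wg; apply: expr_le_flip_cost => //.
  by apply: leq_trans wg _; rewrite leq_add2r.
rewrite -(bigA_distr_bigA (fun l y => flip_cost z (f l) y)).
have -> : (1 + z) ^+ k = \prod_(l < k) (1 + z) by rewrite prodr_const card_ord.
apply: ler_prod => l _.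
apply/andP; split; last by rewrite flip_cost_row // ltW.
by apply: sumr_ge0 => y _; rewrite flip_cost_ge0 // ltW.
Qed.

(** From [1 - t <= expR (- t)] follows [expR t * (1 - t) <= 1], while [(1 + t + 2 t^2) (1 - t) = 1 +
    t^2 (1 - 2 t) >= 1]. Negative [t] is allowed, for the lower tail. *)
Lemma expR_le_quadratic (R : realType) (t : R) :
  t <= 2^-1 -> expR t <= 1 + t + 2 * t ^+ 2.
Proof.
move=> t2; have t1 : 0 < 1 - t by lra.
rewrite -(ler_pM2r t1); apply: (@le_trans _ _ (expR t * expR (- t))).
  by rewrite ler_wpM2l ?expR_ge0 // expR_ge1Dx.
rewrite expRxMexpNx_1; have := sqr_ge0 t; nra.
Qed.

Lemma exprn_1D_le_expR (R : realType) (u : R) (k : nat) :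
  0 <= 1 + u -> (1 + u) ^+ k <= expR (k%:R * u).
Proof. by move=> u1; rewrite expRM_natl lerXn2r ?nnegrE ?expR_ge0 ?expR_ge1Dx. Qed.

(** * Windows of weights *)

Definition card_outside (d k a b : nat) : nat :=
  (#|[pred f : {ffun 'I_k -> 'I_d} | (weight f < a)%N]| +
   #|[pred f : {ffun 'I_k -> 'I_d} | (b < weight f)%N]|)%N.

Definition card_inside (d k a b : nat) : nat :=
  #|[pred f : {ffun 'I_k -> 'I_d} | (a <= weight f <= b)%N]|.

Lemma card_insideD (d k a b : nat) : (a <= b)%N ->
  (card_inside d k a b + card_outside d k a b = d ^ k)%N.
Proof.
move=> ab; have -> : (d ^ k)%N = #|{: {ffun 'I_k -> 'I_d}}| by rewrite card_ffun !card_ord.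
rewrite /card_inside /card_outside.
rewrite -(cardC [pred f : {ffun 'I_k -> 'I_d} | (a <= weight f <= b)%N]); congr (_ + _)%N.
rewrite -cardUI [X in (_ + X)%N]eq_card0 ?addn0 => [|f]; last by rewrite !inE; lia.
apply: eq_card => f; rewrite !inE; lia.
Qed.

(** Pigeonhole: [q] consecutive windows of [s + 1] weights cover [[a, b]], and the fullest one is
    taken. *)
Lemma exists_heavy_window (d k a b s q : nat) : (0 < q)%N -> (b < a + q * s.+1)%N ->
  exists2 i, (i < q)%N &
    (card_inside d k a b <= q * card_inside d k (a + i * s.+1) (a + i * s.+1 + s))%N.
Proof.
case: q => // q _ b_lt.
pose F i := card_inside d k (a + i * s.+1) (a + i * s.+1 + s).
have [i _ imax] := @arg_maxnP _ (@ord0 q) xpredT F isT.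
exists i => //; apply: (@leq_trans (\sum_(j < q.+1) F j)); last first.
  apply: (@leq_trans (\sum_(j < q.+1) F i)); last by rewrite sum_nat_const card_ord.
  by apply: leq_sum => j _; apply: imax.
rewrite /F /card_inside -sum1_card big_mkcond /=.
under [X in (_ <= X)%N]eq_bigr do rewrite -sum1_card big_mkcond /=.
rewrite exchange_big /=; apply: leq_sum => f _; rewrite inE; case: ifP => // /andP[aw wb].
(* The quotient is the index of the window that contains [weight f]. *)
have jq : ((weight f - a) %/ s.+1 < q.+1)%N by rewrite ltn_divLR //; lia.
rewrite (bigD1 (Ordinal jq)) //= inE.
have := divn_eq (weight f - a) s.+1; have := ltn_pmod (weight f - a) (ltn0Sn s).
by move=> h1 h2; rewrite (_ : (_ <= _ <= _)%N = true) //; lia.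
Qed.

(** * Concentration of the weight around its mean *)

Section Weights.
Variables (R : realType) (d k : nat).
Hypothesis d_gt0 : (0 < d)%N.
Let mu : R := k%:R / d%:R.
Local Notation T := {ffun 'I_k -> 'I_d}.

Let dR_gt0 : 0 < d%:R :> R.
Proof. by rewrite ltr0n. Qed.

Let predn_dE : d.-1%:R = d%:R - 1 :> R.
Proof. by rewrite -{2}(prednK d_gt0) -natr1 addrK. Qed.

(** The weight of a uniform word is binomial with parameters [k] and [1 / d]; by [1 + u <= expR u]
    its moment generating function is at most that of a Poisson variable of mean [mu]. *)
Lemma sum_expR_weight (t : R) :
  \sum_(f : T) expR (t * (weight f)%:R) <= (d ^ k)%:R * expR (mu * (expR t - 1)).
Proof.
under eq_bigr do rewrite expRM_natr.
rewrite sum_expr_weight // predn_dE.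
have -> : d%:R - 1 + expR t = d%:R * (1 + (expR t - 1) / d%:R) by field; rewrite ?lt0r_neq0.
rewrite exprMn natrX ler_wpM2l ?exprn_ge0 //.
have -> : mu * (expR t - 1) = k%:R * ((expR t - 1) / d%:R) by rewrite /mu; field; rewrite ?lt0r_neq0.
apply: exprn_1D_le_expR.
have -> : 1 + (expR t - 1) / d%:R = (d.-1%:R + expR t) / d%:R by rewrite predn_dE; field; rewrite ?lt0r_neq0.
by rewrite divr_ge0 ?addr_ge0 ?expR_ge0 ?ler0n.
Qed.

(** The threshold is put on [t * weight f], so that the sign of [t] selects the tail. *)
Lemma chernoff (t v : R) (P : pred T) : t <= 2^-1 ->
  (forall f, P f -> v <= t * (weight f)%:R) ->
  #|P|%:R <= (d ^ k)%:R * expR (mu * (t + 2 * t ^+ 2) - v).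
Proof.
move=> t2 Pv; rewrite expRB mulrA ler_pdivlMr ?expR_gt0 //.
apply: (@le_trans _ _ (\sum_(f : T) expR (t * (weight f)%:R))).
  by apply: card_le_sum => f; rewrite ?expR_ge0 // => Pf; rewrite ler_expR Pv.
apply: le_trans (sum_expR_weight t) _; rewrite ler_wpM2l // ler_expR.
rewrite ler_wpM2l ?divr_ge0 //.
by have := expR_le_quadratic t2; lra.
Qed.

(** The choice [|t| = h / (4 mu)] minimizes [2 mu t^2 - h |t|], with value [- h^2 / (8 mu)]. The
    successor at the lower end puts outside exactly the low weights that are at most [mu - h]. *)
Lemma card_outside_le_exp (h : R) (b : nat) : (0 < k)%N -> 0 <= h -> h <= mu ->
  mu + h <= b.+1%:R ->
  (card_outside d k (Num.truncn (mu - h)).+1 b)%:R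
    <= 2 * ((d ^ k)%:R * expR (- (h ^+ 2 / (8 * mu)))).
Proof.
move=> k_gt0 h0 hmu hb; have mu0 : 0 < mu by rewrite divr_gt0 ?ltr0n.
have hm : 0 <= h / (4 * mu) by rewrite divr_ge0 // mulr_ge0 // ltW.
have hm2 : h / (4 * mu) <= 2^-1 by rewrite ler_pdivrMr; lra.
rewrite natrD mulr2n mulrDl mul1r lerD //.
  apply: le_trans (@chernoff (- (h / (4 * mu))) (- (h / (4 * mu)) * (mu - h)) _ _ _) _.
  - lra.
  - move=> f /=; rewrite ltnS truncn_ge_nat ?subr_ge0 // => wf.
    by rewrite !mulNr lerN2 ler_wpM2l.
  - by rewrite ler_wpM2l // ler_expR le_eqVlt; apply/orP; left; apply/eqP; field; rewrite ?lt0r_neq0.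
apply: le_trans (@chernoff (h / (4 * mu)) (h / (4 * mu) * (mu + h)) _ _ _) _ => //.
- move=> f /= wf; rewrite ler_wpM2l // (le_trans hb) // ler_nat //.
- by rewrite ler_wpM2l // ler_expR le_eqVlt; apply/orP; left; apply/eqP; field; rewrite ?lt0r_neq0.
Qed.

(** There are [(d - 1) ^ k] words of weight 0, a fraction of at least [expR (- (2 * mu))] because
    [(1 - 1 / d) (1 + 2 / d) >= 1] for [d >= 2]. The rest is a fraction of at most
    [1 - c <= expR (- c)]. *)
Lemma card_outside_origin (c : R) : (1 < d)%N -> c <= expR (- (2 * mu)) ->
  (card_outside d k 0 0)%:R <= (d ^ k)%:R * expR (- c).
Proof.
move=> d_gt1 c_le; have d2 : 2 <= d%:R :> R by rewrite (ler_nat _ 2).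
have in0 : (card_inside d k 0 0)%:R = d.-1%:R ^+ k :> R.
  rewrite -[d.-1%:R]addr0 -sum_expr_weight // /card_inside -sum1_card natr_sum big_mkcond /=.
  by apply: eq_bigr => f _; rewrite inE leqn0 expr0n; case: ifP.
have : (d ^ k)%:R * expR (- (2 * mu)) <= d.-1%:R ^+ k.
  have -> : d.-1%:R = d%:R * (1 - d%:R^-1) :> R by rewrite predn_dE; field; rewrite ?lt0r_neq0.
  rewrite exprMn natrX ler_wpM2l ?exprn_ge0 //.
  have -> : - (2 * mu) = k%:R * - (2 / d%:R) by rewrite /mu; field; rewrite ?lt0r_neq0.
  have di0 : 0 < d%:R^-1 :> R by rewrite invr_gt0.
  have di2 : d%:R^-1 <= 2^-1 :> R by rewrite lef_pV2 ?posrE //; lra.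
  rewrite expRM_natl lerXn2r ?nnegrE ?expR_ge0 //; first lra.
  rewrite expRN -[leLHS]mul1r ler_pdivrMr ?expR_gt0 //.
  apply: (@le_trans _ _ ((1 - d%:R^-1) * (1 + 2 / d%:R))); first by nra.
  by rewrite ler_wpM2l ?expR_ge1Dx //; lra.
have := card_insideD d k (leqnn 0) => /(congr1 (fun n => n%:R : R)); rewrite natrD in0 => sumE.
have dk0 : 0 <= (d ^ k)%:R :> R by [].
have := expR_ge1Dx (- c); rewrite -sumE in dk0 *.
by move: (d.-1%:R ^+ k) (card_outside d k 0 0)%:R (expR (- c)) (expR (- (2 * mu))) c_le dk0
  => A B C D; nra.
Qed.

End Weights.

(** * Choice of the window *)

Definition window_const (R : realType) (kappa : R) : R := kappa ^+ 2 / 800 * expR (- 32).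

(** Used with [rho = eps / L]: the first two bounds keep compatible words few, the third bounds the
    rank. In [window_const], the factor [expR (- 32)] is there for [mu < 16], where
    [2 * mu <= 32]. *)
Lemma exists_window (R : realType) (d k : nat) (mu kappa rho : R) :
  mu = k%:R / d%:R ->
  (1 < d)%N -> (0 < k)%N -> 0 < kappa -> kappa <= 4^-1 -> 0 < rho -> rho <= 2 ->
  exists a s : nat, [/\ (a + s)%:R <= 5 * mu, s%:R <= kappa * mu * rho &
    (card_outside d k a (a + s))%:R
      <= (d ^ k)%:R * expR (- (window_const kappa * (mu * rho ^+ 2)))].
Proof.
move=> muE d_gt1 k_gt0 ka0 ka4 rho0 rho2; have d_gt0 := ltnW d_gt1.
have mu0 : 0 < mu by rewrite muE divr_gt0 ?ltr0n.
have out_exp h b : 0 <= h -> h <= mu -> mu + h <= b.+1%:R ->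
    (card_outside d k (Num.truncn (mu - h)).+1 b)%:R
      <= 2 * ((d ^ k)%:R * expR (- (h ^+ 2 / (8 * mu)))).
  by rewrite muE; apply: card_outside_le_exp.
have n0 : 0 < (d ^ k)%:R :> R by rewrite ltr0n expn_gt0 d_gt0.
have e0 : 0 < expR (- 32) :> R by rewrite expR_gt0.
have e1 : expR (- 32) <= 1 :> R by rewrite -[leRHS]expR0 ler_expR; lra.
have ka2 : 0 < kappa ^+ 2 by rewrite exprn_gt0.
have rh2 : 0 < rho ^+ 2 by rewrite exprn_gt0.
have c0_le : window_const kappa <= kappa ^+ 2 / 800.
  by rewrite /window_const ler_piMr // divr_ge0 // ltW.
(* For bounded [mu] the single weight [0] already carries a constant fraction. *)
have [mu_lt|mu_ge] := ltP mu 16.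
  exists 0%N, 0%N; split.
  - by rewrite mulr_ge0 // ltW.
  - by rewrite !mulr_ge0 // ltW.
  apply: card_outside_origin => //.
  apply: (@le_trans _ _ (expR (- 32))); last by rewrite ler_expR -muE; lra.
  rewrite /window_const mulrAC ler_piMl ?ltW //.
  have k16 : kappa ^+ 2 <= 1 by rewrite exprn_ile1 ?ltW //; lra.
  have r4 : mu * rho ^+ 2 <= 64.
    have -> : 64 = 16 * 2 ^+ 2 :> R by ring.
    apply: ler_pM; [exact: ltW|exact: ltW|exact: ltW|].
    by rewrite lerXn2r // nnegrE ltW.
  have mr0 : 0 <= mu * rho ^+ 2 by rewrite mulr_ge0 ?ltW.
  nra.
set s := Num.truncn (kappa * mu * rho).
have kmr0 : 0 <= kappa * mu * rho by rewrite !mulr_ge0 // ltW.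
have /andP[s_le s_ge] : s%:R <= kappa * mu * rho < s.+1%:R by apply: truncn_itv.
have s_le_mu : s%:R <= mu / 2.
  apply: le_trans s_le _; rewrite mulrAC [leRHS]mulrC ler_pM2r //.
  by nra.
(* The threshold is [16 ^ 2]. Above it the Chernoff exponent absorbs the factor 2 from the two
   tails; below it [kappa * sqrt mu * rho <= 16] limits the pigeonhole loss. *)
have [big|small] := leP (256 : R) (kappa ^+ 2 * (mu * rho ^+ 2)).
  (* Half the width of a window centered at [mu]; since [kappa * mu * rho >= 2], rounding down to
     [s] loses at most a factor 2. *)
  pose h : R := s%:R / 2.
  have h0 : 0 <= h by rewrite divr_ge0.
  have hmu : h <= mu by rewrite /h; lra.
  have kmr2 : 2 <= kappa * mu * rho.
    have kr1 : kappa * rho <= 1 by nra.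
    have := big; rewrite (_ : _ * _ = (kappa * mu * rho) * (kappa * rho)); last by ring.
    nra.
  have h_ge : kappa * mu * rho / 4 <= h by rewrite /h; move: s_ge; rewrite -natr1; lra.
  exists (Num.truncn (mu - h)).+1, s; split => //.
    have /andP[t_le _] := @truncn_itv R (mu - h) ltac:(lra).
    by rewrite natrD -natr1; lra.
  apply: le_trans (out_exp _ _ h0 hmu _) _.
    rewrite -addnS natrD -natr1; have := truncnS_gt (mu - h); rewrite -!natr1 /h; lra.
  rewrite mulrCA ler_pM2l //.
  (* The Chernoff exponent [h^2 / (8 mu)] is at least [2 E]; one [E] pays for the factor 2, as
     [2 <= 1 + E <= expR E]. *)
  set E := kappa ^+ 2 * (mu * rho ^+ 2) / 256.
  apply: (@le_trans _ _ (2 * expR (- (E + E)))).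
    rewrite ler_pM2l // ler_expR lerN2 ler_pdivlMr; last lra.
    have -> : (E + E) * (8 * mu) = (kappa * mu * rho / 4) ^+ 2 by rewrite /E; field.
    by rewrite lerXn2r ?nnegrE //; lra.
  apply: (@le_trans _ _ (expR (- E))).
    rewrite opprD expRD mulrA ler_piMl ?expR_ge0 // expRN ler_pdivrMr ?expR_gt0 // mul1r.
    apply: le_trans (expR_ge1Dx E); rewrite /E; lra.
  rewrite ler_expR lerN2 /E [leRHS]mulrAC ler_pM2r ?mulr_gt0 //; lra.
(* The weights within [4 m] of the mean carry at least half of the words, since
   [2 * expR (- 2) <= 1 / 2]; [mu >= 16] ensures [4 m <= mu]. *)
pose m := Num.sqrt mu.
have mE : m ^+ 2 = mu by rewrite sqr_sqrtr // ltW.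
have m0 : 0 <= m by rewrite sqrtr_ge0.
have m4 : 4 <= m by rewrite -(@ler_pXn2r _ 2) ?nnegrE // mE; lra.
have h0 : 0 <= 4 * m by lra.
have hmu : 4 * m <= mu by rewrite -mE; nra.
set a0 := (Num.truncn (mu - 4 * m)).+1; set S := Num.truncn (8 * m).
have /andP[S_le S_ge] : S%:R <= 8 * m < S.+1%:R by apply: truncn_itv; lra.
have a0_gt : mu - 4 * m < a0%:R by apply: truncnS_gt.
have a0_le : a0%:R <= mu - 4 * m + 1.
  by rewrite /a0 -natr1 lerD2r; have /andP[] := @truncn_itv R (mu - 4 * m) ltac:(lra).
have out_le : (card_outside d k a0 (a0 + S))%:R <= (d ^ k)%:R / 2 :> R.
  apply: le_trans (out_exp _ _ h0 hmu _) _.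
    by rewrite -addnS natrD; lra.
  rewrite -mE (_ : (4 * m) ^+ 2 / _ = 2); last by field; lra.
  rewrite mulrCA ler_pM2l // (_ : - 2 = - 1 + - 1) ?expRD; last by ring.
  have := expR_ge1Dx (1 : R); have := expR_gt0 (1 : R).
  have : expR (- 1) * expR 1 = 1 :> R by rewrite -expRD addNr expR0.
  have := expR_gt0 (- 1 : R); nra.
have in_ge : (d ^ k)%:R / 2 <= (card_inside d k a0 (a0 + S))%:R :> R.
  have := card_insideD d k (leq_addr S a0).
  by move/(congr1 (fun n => n%:R : R)); rewrite natrD; lra.
(* Enough windows of [s + 1] weights to cover the [S + 1] weights from [a0] to [a0 + S]. *)
set q := (S %/ s.+1).+1.
have [i iq heavy] : exists2 i, (i < q)%N & (card_inside d k a0 (a0 + S) <=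
    q * card_inside d k (a0 + i * s.+1) (a0 + i * s.+1 + s))%N.
  by apply: exists_heavy_window => //; rewrite ltn_add2l ltn_ceil.
have iS : (i * s.+1 <= S)%N.
  by apply: leq_trans (leq_divM S s.+1); rewrite leq_mul2r -ltnS iq orbT.
have qS : (q%:R - 1) * s.+1%:R <= S%:R :> R.
  by rewrite /q -natr1 addrK -natrM ler_nat leq_divM.
exists (a0 + i * s.+1)%N, s; split => //.
  have : (a0 + i * s.+1 + s)%:R <= (a0 + S + s)%:R :> R.
    by rewrite ler_nat leq_add2r leq_add2l.
  rewrite !natrD; nra.
set c1 := card_inside _ _ _ (_ + s) in heavy.
have := card_insideD d k (leq_addr s (a0 + i * s.+1)).
move/(congr1 (fun n => n%:R : R)); rewrite natrD -/c1 => sumE.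
set x := window_const kappa * _.
have heavyR : (d ^ k)%:R / 2 <= q%:R * c1%:R :> R.
  by apply: le_trans in_ge _; rewrite -natrM ler_nat.
have x_ge0 : 0 <= x.
  by apply/ltW; rewrite /x /window_const !mulr_gt0 // invr_gt0 ltr0n.
have q1 : 1 <= q%:R :> R by rewrite ler1n.
(* From [s + 1 > m r] comes [(q - 1) r <= 8]; with [r <= 16] this gives [q r^2 <= 24 * 16], and
   [2 * 384 < 800]. The heavy window thus holds a fraction of at least [1 / (2 q) >= x]. *)
have qx : 2 * q%:R * x <= 1.
  pose r := kappa * m * rho.
  have r0 : 0 <= r by rewrite !mulr_ge0 // ltW.
  have rE : kappa ^+ 2 * (mu * rho ^+ 2) = r ^+ 2 by rewrite -mE /r; ring.
  have r16 : r <= 16.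
    by rewrite -(@ler_pXn2r _ 2) ?nnegrE // -rE; lra.
  have qr : (q%:R - 1) * r <= 8.
    have : (q%:R - 1) * (m * r) <= 8 * m.
      apply: le_trans S_le; apply: le_trans qS; rewrite ler_wpM2l ?subr_ge0 //.
      by rewrite /r; move: s_ge; rewrite -mE; lra.
    by move=> ?; rewrite -(@ler_pM2l _ m); lra.
  have xr : x <= r ^+ 2 / 800.
    by rewrite -rE /x [leRHS]mulrAC ler_pM2r ?mulr_gt0.
  nra.
have : c1%:R >= (d ^ k)%:R * x :> R by nra.
have := expR_ge1Dx (- x); nra.
Qed.

(** * Sparsity estimate and the rigidity bound *)

Lemma ln2_ge (R : realType) : 2^-1 <= ln 2 :> R.
Proof.
rewrite -ler_expR lnK ?posrE //.
have := expR_ge1Dx (- 2^-1 : R); have := expR_gt0 (2^-1 : R).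
have : expR (2^-1) * expR (- 2^-1) = 1 :> R by rewrite -expRD subrr expR0.
nra.
Qed.

Lemma powR_natX (R : realType) (d k : nat) (x : R) : (0 < d)%N ->
  (d ^ k)%:R `^ x = expR (x * (k%:R * ln d%:R)).
Proof.
move=> d_gt0; have dk0 : (0 < d ^ k)%N by rewrite expn_gt0 d_gt0.
rewrite /powR pnatr_eq0 gtn_eqF //=.
by rewrite natrX lnXn ?ltr0n // mulr_natl.
Qed.

(** The logarithm of the first factor is [s * (ln 20 + ln d + ln eps^-1)]. The division by [L] in
    the bound on [s] pays for [ln eps^-1], and [L >= 1 / 2] for [ln 20]; then [ln d >= 1 / 2] turns
    all multiples of [mu * eps] into multiples of [mu * eps * ln d]. *)
Lemma sparsity_bound (R : realType) (d s : nat) (m mu eps L : R) :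
  (1 < d)%N -> 0 < mu -> 0 < eps -> 2^-1 <= L -> ln eps^-1 <= L ->
  m <= 5 * mu -> s%:R <= 200^-1 * mu * (eps / L) ->
  (eps / (20 * d%:R)) ^- s * expR (m * (eps / 20)) <= expR (eps * mu * ln d%:R).
Proof.
move=> d_gt1 mu0 eps0 L2 epsL m_le s_le.
have d0 : 0 < d%:R :> R by rewrite ltr0n ltnW.
have lnd : 2^-1 <= ln d%:R :> R.
  by apply: le_trans (ln2_ge R) _; rewrite ler_ln ?posrE // (ler_nat _ 2).
have -> : (eps / (20 * d%:R)) ^- s = expR (s%:R * (ln 20 + ln d%:R + ln eps^-1)).
  rewrite expRM_natl -exprVn -!lnM ?posrE ?mulr_gt0 ?invr_gt0 // lnK ?posrE ?mulr_gt0 ?invr_gt0 //.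
  by rewrite invf_div.
rewrite -expRD ler_expR.
have ln20 : ln 20 <= 20 :> R by apply/ltW/ln_sublinear.
have sL : s%:R * L <= mu * eps / 200.
  move: s_le; rewrite -(@ler_pM2r _ L); last lra.
  by rewrite -!mulrA mulVf ?mulr1; [rewrite !mulrA [200^-1 * _]mulrC mulrAC|lra].
have s0 : 0 <= s%:R :> R by [].
have me0 : 0 < mu * eps by rewrite mulr_gt0.
have s1 : s%:R <= mu * eps / 100 by nra.
have t1 : s%:R * ln 20 <= mu * eps / 5 by nra.
have t2 : s%:R * ln eps^-1 <= mu * eps / 200.
  by apply: le_trans sL; rewrite ler_wpM2l.
have t3 : s%:R * ln d%:R <= mu * eps / 100 * ln d%:R by rewrite ler_wpM2r //; lra.
have t4 : m * (eps / 20) <= mu * eps / 4 by nra.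
have t5 : mu * eps / 2 <= mu * eps * ln d%:R by nra.
nra.
Qed.

Theorem theorem4p1 (R : realType) :
  exists c C : R, 0 < c /\ 0 < C /\
  forall (d : nat) (eps : R), (2 <= d)%N -> 0 < eps -> eps < 1 ->
  exists gamma : R,
    c * gamma_rate d eps <= gamma /\ gamma <= C * gamma_rate d eps /\
    forall (F : fieldType) (k : nat) (X : 'M[F]_(d, k)), (1 <= k)%N ->
      let n := (d ^ k)%N in
      (rc_rigidity (Gkmx X) (Num.truncn (n%:R `^ (1 - gamma))))%:R
        <= n%:R `^ (eps / d%:R).
Proof.
pose c : R := window_const 200^-1.
have c0 : 0 < c by rewrite /c /window_const !mulr_gt0 ?expR_gt0 ?invr_gt0 ?exprn_gt0
  ?invr_gt0 ?ltr0n.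
(* One constant serves both sides, as [gamma] is exactly [c] times the rate. *)
exists c, c; split=> //; split=> // d eps d_gt1 eps0 eps1.
exists (c * gamma_rate d eps); split=> //; split=> // F k X k_gt0 /=.
have d_gt0 := ltnW d_gt1.
have d0 : 0 < d%:R :> R by rewrite ltr0n.
set L := ln (Num.max 2 eps^-1).
have L2 : 2^-1 <= L.
  apply: le_trans (ln2_ge R) _; rewrite ler_ln ?posrE ?lt_max ?ltr0n //.
  by rewrite le_max lexx.
have epsL : ln eps^-1 <= L.
  by rewrite ler_ln ?posrE ?lt_max ?invr_gt0 ?ltr0n // le_max lexx orbT.
have L0 : 0 < L by lra.
have rho0 : 0 < eps / L by rewrite divr_gt0.
have rho2 : eps / L <= 2 by rewrite ler_pdivrMr //; lra.
have lnd0 : 0 < ln d%:R :> R by rewrite ln_gt0 // ltr1n.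
pose mu : R := k%:R / d%:R; have mu0 : 0 < mu by rewrite divr_gt0 ?ltr0n.
have ka0 : 0 < 200^-1 :> R by rewrite invr_gt0 ltr0n.
have ka4 : 200^-1 <= 4^-1 :> R by lra.
have [a [s [as_le s_le out_le]]] :=
  exists_window (erefl mu) d_gt1 k_gt0 ka0 ka4 rho0 rho2.
set T := (d ^ k)%:R `^ (eps / d%:R).
have TE : T = expR (eps * mu * ln d%:R).
  by rewrite /T powR_natX // /mu; congr expR; field; rewrite lt0r_neq0.
have T0 : 0 <= T by rewrite TE expR_ge0.
(* Chosen so that [d * z = eps / 20] and [k * z = mu * eps / 20]: columns ([m = a + s]) and rows
   ([m = mu]) then share one estimate. *)
pose z : R := eps / (20 * d%:R).
have z0 : 0 < z by rewrite divr_gt0 // mulr_gt0.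
have d2 : 2 <= d%:R :> R by rewrite (ler_nat _ 2).
have z1 : z <= 1 by rewrite ler_pdivrMr ?mulr_gt0 //; lra.
have bound u m (j : nat) : m <= 5 * mu -> 0 <= u -> j%:R * u <= m * (eps / 20) ->
    z ^- s * (1 + u) ^+ j <= T.
  move=> m_le u0 ju; rewrite TE.
  apply: le_trans (sparsity_bound d_gt1 mu0 eps0 L2 epsL m_le s_le).
  rewrite ler_pM2l ?invr_gt0 ?exprn_gt0 //.
  apply: le_trans (exprn_1D_le_expR _ _) _; first by rewrite addr_ge0.
  by rewrite ler_expR.
apply: (@le_trans _ _ (Num.truncn T)%:R); last by rewrite truncn_le.
rewrite ler_nat; apply: rc_rigidity_le.
have [g wg|f wf|Z [rk_le Z_sparse]] := @rc_approx_Gkmx F d k X a (a + s) (Num.truncn T).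
- rewrite truncn_ge_nat //; apply: le_trans (card_compat_col z0 z1 wg) _.
  apply: (bound _ (a + s)%:R) => //; first by rewrite mulr_ge0 // ltW.
  rewrite ler_wpM2l // (_ : eps / 20 = d%:R * z); last by rewrite /z; field; rewrite lt0r_neq0.
  by rewrite ler_pM2r // ler_nat leq_pred.
- rewrite truncn_ge_nat //; apply: le_trans (card_compat_row _ z0 z1 wf) _.
  apply: (bound _ mu); [lra|exact: ltW|].
  by rewrite le_eqVlt; apply/orP; left; apply/eqP; rewrite /z /mu; field; rewrite lt0r_neq0.
exists Z; split=> //; apply: leq_trans rk_le _; rewrite truncn_ge_nat ?powR_ge0 //.
apply: le_trans out_le _; rewrite powR_natX // mulrBl mul1r expRD.
rewrite [expR (_ * ln _)]expRM_natl lnK ?posrE // -natrX ler_wpM2l // ler_expR lerN2.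
(* The [ln d] in the rate cancels the one in [ln n = k ln d], so
   [gamma * ln n = c * mu * (eps / L) ^ 2]. *)
rewrite le_eqVlt; apply/orP; left; apply/eqP; rewrite /c /gamma_rate -/L /mu.
by field; rewrite !lt0r_neq0.
Qed.
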